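(* Let $\Gamma$ be a finite simplicial graph. If $A_\Gamma$ admits a stable quasiisometric embedding in a finite direct product of finite-rank free groups, then $A_\Gamma$ is itself a direct product of finite-rank free groups.
   Context: For a simplicial graph $\Gamma$, the right-angled Artin group $A_\Gamma$ has one generator $s_v$ for each vertex $v$ of $\Gamma$ (the standard generators), with relations $s_vs_w=s_ws_v$ whenever $v,w$ are adjacent; it carries the corresponding word metric. A finite direct product of finite-rank free groups is regarded as the right-angled Artin group $A_\Lambda$, where $\Lambda$ is a finite join of finite edgeless graphs. A standard geodesic of $A_\Gamma$ is a coset $g\langle s\rangle$ with $g\in A_\Gamma$ and $s$ a standard generator. A quasiisometric embedding $\varphi:A_\Gamma\to A_\Lambda$ is stable if there is a constant $D$ such that $\varphi$ sends every standard geodesic of $A_\Gamma$ within Hausdorff distance at most $D$ of some standard geodesic of $A_\Lambda$. *)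

(* Defs.v *)
From HB Require Import structures.
From mathcomp Require Import all_boot all_order all_algebra.
From mathcomp Require Import boolp classical_sets reals.

Set Implicit Arguments.
Unset Strict Implicit.
Unset Printing Implicit Defensive.

Local Open Scope group_scope.
Local Open Scope quotient_scope.
Local Open Scope classical_set_scope.

(* The letter (s, false) is the generator s and (s, true) is its formal inverse. *)
Definition letter (S : Type) := (S * bool)%type.
Definition word (S : Type) := seq (letter S).

Definition inv_letter (S : Type) (a : letter S) : letter S := (a.1, ~~ a.2).
Definition inv_word (S : Type) (w : word S) : word S :=
  rev (map (@inv_letter S) w).

(* The smallest congruence on words containing the relations [rel] and the
   cancellations of a letter with its inverse. *)
Inductive pres_eq (S : Type) (rel : word S -> word S -> Prop) :
    word S -> word S -> Prop :=
| pres_rel u v : rel u v -> pres_eq rel u v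
| pres_cancel a : pres_eq rel [:: a; inv_letter a] [::]
| pres_refl u : pres_eq rel u u
| pres_sym u v : pres_eq rel u v -> pres_eq rel v u
| pres_trans u v w : pres_eq rel u v -> pres_eq rel v w -> pres_eq rel u w
| pres_cat u u' v v' : pres_eq rel u u' -> pres_eq rel v v' ->
    pres_eq rel (u ++ v) (u' ++ v').

Section Presentation.
Variables (S : choiceType) (rel : word S -> word S -> Prop).

Definition pres_eqb (u v : word S) : bool := `[< pres_eq rel u v >].

Lemma pres_eqb_refl : reflexive pres_eqb.
Proof. by move=> u; apply/asboolP; apply: pres_refl. Qed.

Lemma pres_eqb_sym : symmetric pres_eqb.
Proof. by move=> u v; apply/asboolP/asboolP; apply: pres_sym. Qed.

Lemma pres_eqb_trans : transitive pres_eqb.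
Proof.
by move=> v u w /asboolP uv /asboolP vw; apply/asboolP; apply: pres_trans vw.
Qed.

Canonical pres_equiv :=
  EquivRel pres_eqb pres_eqb_refl pres_eqb_sym pres_eqb_trans.

Definition pres_group := {eq_quot pres_equiv}.

HB.instance Definition _ := Choice.on pres_group.

Definition pres_class (w : word S) : pres_group := \pi w.
Definition pres_repr (x : pres_group) : word S := repr x.

Lemma pres_reprK : cancel pres_repr pres_class.
Proof. by move=> x; apply: reprK. Qed.

Lemma pres_classP (u v : word S) :
  pres_class u = pres_class v <-> pres_eq rel u v.
Proof. by split=> [/eqmodP/asboolP|uv] //; apply/eqmodP/asboolP. Qed.

Definition pres_mul (x y : pres_group) : pres_group :=
  pres_class (pres_repr x ++ pres_repr y).
Definition pres_one : pres_group := pres_class [::].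
Definition pres_inv (x : pres_group) : pres_group :=
  pres_class (inv_word (pres_repr x)).

Lemma pres_mulE u v :
  pres_mul (pres_class u) (pres_class v) = pres_class (u ++ v).
Proof.
by apply/pres_classP; apply: pres_cat; apply/pres_classP; rewrite pres_reprK.
Qed.

Lemma pres_mulA : associative pres_mul.
Proof.
move=> x y z; rewrite -(pres_reprK x) -(pres_reprK y) -(pres_reprK z).
by rewrite !pres_mulE catA.
Qed.

Lemma pres_mul1 : left_id pres_one pres_mul.
Proof. by move=> x; rewrite -(pres_reprK x) pres_mulE. Qed.

Lemma pres_mulr1 : right_id pres_one pres_mul.
Proof. by move=> x; rewrite -(pres_reprK x) pres_mulE cats0. Qed.

Lemma inv_letterK : involutive (@inv_letter S).
Proof. by case=> s b; rewrite /inv_letter /= negbK. Qed.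

Lemma inv_wordK : involutive (@inv_word S).
Proof.
by move=> w; rewrite /inv_word map_rev revK mapK //; apply: inv_letterK.
Qed.

Lemma pres_eq_mulwV w : pres_eq rel (w ++ inv_word w) [::].
Proof.
elim: w => [|a w IHw]; first exact: pres_refl.
rewrite /inv_word map_cons rev_cons -cats1 catA cat_cons -cat1s.
apply: pres_trans (pres_cancel _ a).
apply: (@pres_cat _ _ _ [:: a] _ [:: inv_letter a]); last exact: pres_refl.
by apply: (@pres_cat _ _ [:: a] [:: a] _ [::]) IHw; apply: pres_refl.
Qed.

Lemma pres_mulrV : right_inverse pres_one pres_inv pres_mul.
Proof.
move=> x; rewrite -{1}(pres_reprK x) pres_mulE.
by apply/pres_classP; apply: pres_eq_mulwV.
Qed.

Lemma pres_mulVr : left_inverse pres_one pres_inv pres_mul.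
Proof.
move=> x; rewrite -{2}(pres_reprK x) pres_mulE; apply/pres_classP.
by rewrite -{2}(inv_wordK (pres_repr x)); apply: pres_eq_mulwV.
Qed.

HB.instance Definition _ := isGroup.Build pres_group
  pres_mulA pres_mul1 pres_mulr1 pres_mulVr pres_mulrV.

Definition pres_gen (s : S) : pres_group := pres_class [:: (s, false)].

Lemma word_length_subproof (x : pres_group) :
  exists n, `[< exists2 w : word S, pres_class w = x & size w = n >].
Proof.
exists (size (pres_repr x)); apply/asboolP; exists (pres_repr x) => //.
exact: pres_reprK.
Qed.

Definition word_length (x : pres_group) : nat := ex_minn (word_length_subproof x).

Definition word_dist (x y : pres_group) : nat := word_length (x^-1 * y).

End Presentation.

Record sgraph := SGraph {
  vertex :> finType;
  adj : rel vertex;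
  adj_sym : symmetric adj;
  adj_irr : irreflexive adj
}.

Inductive raag_rel (G : sgraph) : word G -> word G -> Prop :=
| RaagComm (v w : G) : adj v w ->
    raag_rel [:: (v, false); (w, false)] [:: (w, false); (v, false)].

Notation raag G := (pres_group (@raag_rel G)).

(* All ranks are allowed, including 0. *)
Notation free_group n :=
  (pres_group (fun _ _ : word 'I_n => False)).

Definition edgeless_adj (T : finType) : rel T := fun _ _ => false.

Lemma edgeless_adj_sym (T : finType) : symmetric (@edgeless_adj T).
Proof. by []. Qed.

Lemma edgeless_adj_irr (T : finType) : irreflexive (@edgeless_adj T).
Proof. by []. Qed.

Definition edgeless (T : finType) : sgraph :=
  SGraph (@edgeless_adj_sym T) (@edgeless_adj_irr T).

Section Join.
Variables (I : finType) (G : I -> sgraph).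

Definition join_adj : rel {i : I & G i} := fun u v =>
  (tag u != tag v) || adj (tagged u) (tagged_as u v).

Lemma join_adj_sym : symmetric join_adj.
Proof.
case=> i x [j y]; rewrite /join_adj /= eq_sym.
case: (eqVneq j i) y => [->|//] y.
by rewrite !tagged_asE adj_sym.
Qed.

Lemma join_adj_irr : irreflexive join_adj.
Proof. by case=> i x; rewrite /join_adj /= eqxx tagged_asE adj_irr. Qed.

Definition join : sgraph := SGraph join_adj_sym join_adj_irr.

End Join.

(* The join of k edgeless graphs with r 0, ..., r (k - 1) vertices. *)
Definition join_edgeless (k : nat) (r : 'I_k -> nat) : sgraph :=
  join (fun i : 'I_k => edgeless 'I_(r i)).

Section DirectProduct.
Variables (I : finType) (G : I -> groupType).

Definition direct_prod := {dffun forall i : I, G i}.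

HB.instance Definition _ := Choice.on direct_prod.

Implicit Types x y z : direct_prod.

Definition dprod_mul x y : direct_prod := [ffun i : I => (x i * y i : G i)].
Definition dprod_one : direct_prod := [ffun i : I => (1 : G i)].
Definition dprod_inv x : direct_prod := [ffun i : I => ((x i)^-1 : G i)].

Lemma dprod_mulA : associative dprod_mul.
Proof. by move=> x y z; apply/ffunP => i; rewrite !ffunE mulgA. Qed.

Lemma dprod_mul1 : left_id dprod_one dprod_mul.
Proof. by move=> x; apply/ffunP => i; rewrite !ffunE mul1g. Qed.

Lemma dprod_mulr1 : right_id dprod_one dprod_mul.
Proof. by move=> x; apply/ffunP => i; rewrite !ffunE mulg1. Qed.

Lemma dprod_mulVr : left_inverse dprod_one dprod_inv dprod_mul.
Proof. by move=> x; apply/ffunP => i; rewrite !ffunE mulVg. Qed.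

Lemma dprod_mulrV : right_inverse dprod_one dprod_inv dprod_mul.
Proof. by move=> x; apply/ffunP => i; rewrite !ffunE mulgV. Qed.

HB.instance Definition _ := isGroup.Build direct_prod
  dprod_mulA dprod_mul1 dprod_mulr1 dprod_mulVr dprod_mulrV.

End DirectProduct.

Definition isomorphic_groups (G H : groupType) : Prop :=
  exists f : {multiplicative G -> H}, bijective f.

Definition standard_geodesic (G : sgraph) (X : set (raag G)) : Prop :=
  exists (g : raag G) (v : G),
    X = [set x | exists n : nat,
           x = g * pres_gen _ v ^+ n \/ x = g * pres_gen _ v ^- n].

Local Open Scope ring_scope.

Definition quasiisometric_embedding (R : realType) (G L : sgraph)
    (phi : raag G -> raag L) : Prop :=
  exists K C : R, [/\ 1 <= K, 0 <= C & forall x y : raag G,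
    K^-1 * (word_dist x y)%:R - C <= (word_dist (phi x) (phi y))%:R
      <= K * (word_dist x y)%:R + C].

(* Hausdorff distance at most D; word metrics are integer-valued, so the
   distance from a point to a nonempty set is attained. *)
Definition hausdorff_le (R : realType) (G : sgraph) (D : R)
    (X Y : set (raag G)) : Prop :=
  (forall x, X x -> exists2 y, Y y & (word_dist x y)%:R <= D) /\
  (forall y, Y y -> exists2 x, X x & (word_dist x y)%:R <= D).

Definition stable (R : realType) (G L : sgraph) (phi : raag G -> raag L) : Prop :=
  exists D : R, forall X : set (raag G), standard_geodesic X ->
    exists2 Y : set (raag L), standard_geodesic Y & hausdorff_le D (phi @` X) Y.

(* Main.v *)
Require Import Defs.
From HB Require Import structures.
From mathcomp Require Import all_boot all_order all_algebra.
From mathcomp Require Import boolp classical_sets reals.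
From mathcomp Require Import zify.

Set Implicit Arguments.
Unset Strict Implicit.
Unset Printing Implicit Defensive.

Import Order.TTheory GRing.Theory Num.Theory.

Local Open Scope group_scope.

(** A group A_G is a direct product of free groups as soon as G is complete
    multipartite, i.e. as soon as non-adjacency is transitive: the parts are
    then the bases of the free factors ([multipartite_raag]).  So the point is
    to exclude three vertices a, b, d with a, b adjacent and d adjacent to
    neither, when phi is a stable quasiisometric embedding of A_G in a product
    A_L of free groups F_i.

    A standard geodesic h<s> of A_L moves in one factor only, the one
    containing s; there it runs along an axis of the Cayley tree of F_i, and in
    every other factor it stays at a point.  By stability the image of each
    line g<v> of A_G shadows such a geodesic, which gives the line a factor and
    an axis.  Two facts rule the situation.

    - If two lines of A_G have the same axis in the same factor, their images
      are parallel in A_L, so the lines themselves are within bounded distance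
      of each other ([same_axis_coarse_in]).
    - Conversely, distinct axes of a tree diverge ([lines_apart]), so that lines
      of A_G at bounded distance have the same axis
      ([coarse_in_shadow_axis]).

    Adjacent a and b give different factors at every point
    ([adjacent_shadows]).  Indeed the lines g b^n<a> are parallel to each
    other, hence share one axis; if g<b> lived in the same factor, its image,
    which meets all of them, would run along this axis, and g<a>, g<b> would be
    within bounded distance of each other.

    Now follow the line <d>, in the factor i.  At each d^n one of a, b, say v,
    gives a line d^n<v> whose factor j is not i.  But <d> is almost constant in
    F_j, so the axes of these lines all meet one fixed ball of F_j, and only
    finitely many standard axes do ([far_shadow]).  Hence two lines d^n<v> and
    d^m<v> with m <> n have the same axis, so are within bounded distance, which
    is false since v and d generate a free group ([bridged_lines_diverge],
    [nonadjacent_trans]).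

    The metric input on free groups is only that reduced words are geodesic
    ([reduced_word_length]); it is carried to A_G and A_L by the retractions
    that kill all generators outside an independent set of vertices. *)

(** * Integer powers *)

Section IntegerPowers.
Variables (gT : groupType).
Implicit Types (x y : gT) (z : int).

Definition zpow x z : gT :=
  match z with Posz n => x ^+ n | Negz n => x ^- n.+1 end.

Lemma zpow_succ x z : zpow x (1 + z)%R = x * zpow x z.
Proof.
case: z => [n|[|n]]; first by rewrite -intS /= expgS.
  by rewrite /= expg1 mulgV.
have -> : (1 + Negz n.+1)%R = Negz n by lia.
by rewrite /= [x ^+ n.+2]expgSr invgM mulVKg.
Qed.

Lemma zpow_pred x z : zpow x (z - 1)%R = x^-1 * zpow x z.
Proof.
by have := zpow_succ x (z - 1)%R; rewrite addrC subrK => ->; rewrite mulKg.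
Qed.

Lemma zpowD x z z' : zpow x (z + z')%R = zpow x z * zpow x z'.
Proof.
elim: z => [|n IHn|n IHn]; first by rewrite add0r mul1g.
  by rewrite -[n.+1]add1n PoszD -addrA !zpow_succ IHn mulgA.
have -> : (- n.+1%:Z = - n%:Z - 1)%R by lia.
by rewrite addrAC !zpow_pred IHn mulgA.
Qed.

Lemma zpowN x z : zpow x (- z)%R = (zpow x z)^-1.
Proof.
by apply: (mulgI (zpow x z)); rewrite -zpowD subrr mulgV.
Qed.

Lemma commute_zpow x y z : commute x y -> commute x (zpow y z).
Proof.
move=> cxy; case: z => n /=; first exact: commuteX.
exact/commuteV/commuteX.
Qed.

End IntegerPowers.

Lemma morph_zpow (gT hT : groupType) (f : UMagmaMorphism.type gT hT) x z :
  f (zpow x z) = zpow (f x) z.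
Proof. by case: z => n /=; rewrite ?gmulfV gmulfXn. Qed.

(** * Presented groups: universal property and word length *)

Lemma pres_class_cat (S : choiceType) (rel : word S -> word S -> Prop) u v :
  pres_class rel (u ++ v) = pres_class rel u * pres_class rel v.
Proof. by have := pres_mulE rel u v. Qed.

Section Lift.
Variables (S : choiceType) (rel : word S -> word S -> Prop).
Variables (gT : groupType) (f : S -> gT).

Definition letter_val (a : letter S) : gT := if a.2 then (f a.1)^-1 else f a.1.
Definition word_val (w : word S) : gT := \prod_(a <- w) letter_val a.

Lemma letter_val_inv a : letter_val (inv_letter a) = (letter_val a)^-1.
Proof. by case: a => s [] /=; rewrite /letter_val //= invgK. Qed.

Definition respects := forall u v, rel u v -> word_val u = word_val v.

(** The proof that [f] respects the relations is kept as an argument so that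
    the lift can carry a canonical morphism structure. *)
Definition pres_lift of respects := fun x : pres_group rel =>
  word_val (pres_repr x).

Hypothesis hf : respects.

Lemma word_val_eq u v : pres_eq rel u v -> word_val u = word_val v.
Proof.
elim=> {u v} [u v /hf//|a|//|//|u v w _ -> _ //|u u' v v' _ e _ e'].
  by rewrite /word_val big_cons big_seq1 big_nil letter_val_inv mulgV.
by rewrite /word_val !big_cat /=; congr (_ * _).
Qed.

Lemma pres_lift_class w : pres_lift hf (pres_class rel w) = word_val w.
Proof. by apply/word_val_eq/pres_classP; rewrite pres_reprK. Qed.

Lemma pres_lift_morph : {morph pres_lift hf : x y / x * y}.
Proof.
move=> x y; rewrite -(pres_reprK x) -(pres_reprK y).
by rewrite -pres_class_cat !pres_lift_class /word_val big_cat.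
Qed.

Lemma pres_lift1 : pres_lift hf 1 = 1.
Proof. by apply: (mulgI (pres_lift hf 1)); rewrite -pres_lift_morph !mulg1. Qed.

Lemma pres_lift_gen s : pres_lift hf (pres_gen rel s) = f s.
Proof. by rewrite pres_lift_class /word_val big_seq1. Qed.

End Lift.

HB.instance Definition _ (S : choiceType) (rel : word S -> word S -> Prop)
    (gT : groupType) (f : S -> gT) (hf : respects rel f) :=
  isMultiplicative.Build _ _ (pres_lift hf) (pres_lift_morph hf).
HB.instance Definition _ (S : choiceType) (rel : word S -> word S -> Prop)
    (gT : groupType) (f : S -> gT) (hf : respects rel f) :=
  Multiplicative_isUMagmaMorphism.Build _ _ (pres_lift hf) (pres_lift1 hf).

Section PresentedGroup.
Variables (S : choiceType) (rel : word S -> word S -> Prop).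
Local Notation gen := (pres_gen rel).
Implicit Types (x y : pres_group rel) (w : word S).

Lemma pres_class_letter a : pres_class rel [:: a] = letter_val gen a.
Proof.
case: a => s [] //=; rewrite /letter_val /=.
apply: (mulgI (gen s)); rewrite mulgV -pres_class_cat.
by apply/pres_classP/(pres_cancel _ (s, false)).
Qed.

Lemma pres_class_cons a w :
  pres_class rel (a :: w) = letter_val gen a * pres_class rel w.
Proof. by rewrite -cat1s pres_class_cat pres_class_letter. Qed.

Lemma pres_ind (P : pres_group rel -> Prop) :
  P 1 -> (forall a x, P x -> P (letter_val gen a * x)) -> forall x, P x.
Proof.
move=> P1 PM x; rewrite -(pres_reprK x); elim: (pres_repr x) => // a w IHw.
by rewrite pres_class_cons; apply: PM.
Qed.

Definition zword (s : S) (z : int) : word S := nseq `|z|%N (s, (z < 0)%R).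

Lemma pres_class_zword s z : pres_class rel (zword s z) = zpow (gen s) z.
Proof.
have cls_nseq n b : pres_class rel (nseq n (s, b)) = letter_val gen (s, b) ^+ n.
  by elim: n => [|n IHn] //; rewrite /= pres_class_cons IHn expgS.
by case: z => n; rewrite /zword cls_nseq //= /letter_val /= expVgn.
Qed.

Lemma word_lengthP x :
  exists2 w, pres_class rel w = x & size w = word_length x.
Proof. by rewrite /word_length; case: ex_minnP => n /asboolP [w]; exists w. Qed.

Lemma word_length_class w : word_length (pres_class rel w) <= size w.
Proof.
rewrite /word_length; case: ex_minnP => n _ -> //.
by apply/asboolP; exists w.
Qed.

Lemma word_length1 : word_length (1 : pres_group rel) = 0.
Proof. by apply/eqP; rewrite -leqn0 (word_length_class [::]). Qed.

Lemma word_lengthM x y : word_length (x * y) <= word_length x + word_length y.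
Proof.
have [u <- <-] := word_lengthP x; have [v <- <-] := word_lengthP y.
by rewrite -pres_class_cat -size_cat word_length_class.
Qed.

Lemma word_lengthV x : word_length x^-1 = word_length x.
Proof.
suff le y : word_length y^-1 <= word_length y.
  by apply/eqP; rewrite eqn_leq le -{1}(invgK x) le.
have [w <- <-] := word_lengthP y.
have -> : (pres_class rel w)^-1 = pres_class rel (inv_word w).
  apply: (mulgI (pres_class rel w)); rewrite mulgV -pres_class_cat.
  exact/esym/pres_classP/pres_eq_mulwV.
by apply: leq_trans (word_length_class _) _; rewrite size_rev size_map.
Qed.

Lemma word_dist_sym x y : word_dist x y = word_dist y x.
Proof. by rewrite /word_dist -word_lengthV invgM invgK. Qed.

Lemma word_dist_trans y x z :
  word_dist x z <= word_dist x y + word_dist y z.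
Proof.
rewrite /word_dist; apply: leq_trans (word_lengthM _ _).
by rewrite -mulgA mulVKg.
Qed.

End PresentedGroup.

Lemma word_length_lift (S T : choiceType) (rel : word S -> word S -> Prop)
    (rel' : word T -> word T -> Prop) (f : S -> pres_group rel')
    (hf : respects rel f) x :
  (forall s, word_length (f s) <= 1) ->
  word_length (pres_lift hf x) <= word_length x.
Proof.
move=> f1; have [w <- <-] := word_lengthP x; rewrite pres_lift_class.
elim: w => [|a w IHw]; first by rewrite /word_val big_nil word_length1.
rewrite /word_val big_cons (leq_trans (word_lengthM _ _)) //=.
rewrite -(add1n (size w)) leq_add // /letter_val.
by case: (a.2); rewrite ?word_lengthV.
Qed.

(** * Reduced words and diverging axes in free groups *)

Section FreeGroup.
Variable S : choiceType.
Local Notation norel := (fun _ _ : word S => False).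
Local Notation gen := (pres_gen norel).
Implicit Types (a b : letter S) (u v w : word S) (s t : S).

Definition reduced w := sorted (fun a b => b != inv_letter a) w.

(** Left multiplication by [a] on reduced words.  It makes the free group act
    on the set of reduced words, which tells distinct reduced words apart. *)
Definition push a w :=
  if w is b :: w' then if b == inv_letter a then w' else a :: w else [:: a].

Lemma push_reduced a w : reduced w -> reduced (push a w).
Proof.
case: w => [|b w] //= pw; case: ifP => [_|/negbT ba]; last by rewrite /= ba.
exact: path_sorted pw.
Qed.

(** This cancellation is what makes the action by [push] respect the
    inverses; it would fail on words that are not reduced. *)
Lemma pushK a w : reduced w -> push a (push (inv_letter a) w) = w.
Proof.
case: w => [|b w] /=; first by rewrite eqxx.
rewrite inv_letterK; case: eqP => [->|_ _] /=; last by rewrite eqxx.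
by case: w => [|c w] //= /andP[/negbTE->].
Qed.

Lemma pres_eq_push u v : pres_eq norel u v ->
  forall w, reduced w -> foldr push w u = foldr push w v.
Proof.
have red x w : reduced w -> reduced (foldr push w x).
  by move=> rw; elim: x => //= a x; apply: push_reduced.
elim=> {u v} [//|a w rw|//|u v _ e w rw|u v x _ e _ e' w rw|
  u u' v v' _ e _ e' w rw]; first exact: pushK.
- by rewrite e.
- by rewrite e ?e'.
- by rewrite !foldr_cat e' // e // red.
Qed.

Lemma push_id w : reduced w -> foldr push [::] w = w.
Proof.
elim: w => //= a w IHw pw; rewrite IHw; last exact: path_sorted pw.
by case: w pw {IHw} => [|b w] //= /andP[/negbTE->].
Qed.

Lemma reduced_form w : exists2 v, reduced v &
  pres_class norel v = pres_class norel w /\ size v <= size w.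
Proof.
elim: w => [|a w [v rv [ev sv]]]; first by exists [::].
exists (push a v); first exact: push_reduced.
rewrite pres_class_cons -ev -pres_class_cons; split.
  case: v {rv ev sv} => [|b v] //=; case: eqP => [->|//].
  rewrite !pres_class_cons mulgA letter_val_inv mulgV mul1g //.
case: v rv {ev} sv => [|b v] //= _ sv; case: ifP => // _.
by rewrite ltnW // ltnW.
Qed.

(** Reduction does not lengthen a word, and the action by [push] recovers from
    the group element its unique reduced word. *)
Lemma reduced_word_length w :
  reduced w -> word_length (pres_class norel w) = size w.
Proof.
move=> rw; apply/eqP; rewrite eqn_leq word_length_class /=.
have [v ev <-] := word_lengthP (pres_class norel w).
have [v' rv' [ev' sv']] := reduced_form v.
apply: leq_trans sv'; rewrite -(push_id rw) -(push_id rv').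
by rewrite (@pres_eq_push v' w) //; apply/pres_classP; rewrite ev'.
Qed.

Lemma reduced_cat u v : reduced u -> reduced v ->
  (forall u' a b v', u = rcons u' a -> v = b :: v' -> a.1 != b.1) ->
  reduced (u ++ v).
Proof.
case: u => [|a u] //= pu; case: v => [|b v] rv uv; first by rewrite cats0.
rewrite cat_path pu /=; apply/andP; split=> //.
have := uv (belast a u) (last a u) b v (lastI a u) erefl.
by apply: contra => /eqP->.
Qed.

Lemma reduced_zword s z : reduced (zword s z).
Proof.
rewrite /zword; case: `|z|%N => //= n; elim: n => //= n ->; rewrite andbT.
by rewrite /inv_letter xpair_eqE /=; case: (z < 0)%R; rewrite andbF.
Qed.

Lemma zword_first s z b v : zword s z = b :: v -> b.1 = s.
Proof. by rewrite /zword; case: `|z|%N => //= n [<-]. Qed.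

Lemma zword_last s z u a : zword s z = rcons u a -> a.1 = s.
Proof.
rewrite /zword => e; have : a \in rcons u a by rewrite mem_rcons mem_head.
by rewrite -e => /nseqP[-> _].
Qed.

Lemma size_zword s z : size (zword s z) = `|z|%N.
Proof. exact: size_nseq. Qed.

Lemma zpow_length s z : word_length (zpow (gen s) z) = `|z|%N.
Proof.
by rewrite -pres_class_zword reduced_word_length ?reduced_zword ?size_zword.
Qed.

(** When nothing cancels at either end of [w], the whole word
    [s^x w t^y] is reduced; the case of empty [w] is where [s != t] matters. *)
Lemma lines_apart_reduced s t w x y : reduced w ->
  (w = [::] -> s != t) ->
  (forall b v, w = b :: v -> b.1 != s) ->
  (forall u a, w = rcons u a -> a.1 != t) ->
  `|x|%N <= word_length (zpow (gen s) x * pres_class norel w * zpow (gen t) y).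
Proof.
move=> rw w0 ws wt.
have -> : zpow (gen s) x * pres_class norel w * zpow (gen t) y =
    pres_class norel (zword s x ++ w ++ zword t y).
  by rewrite !pres_class_cat !pres_class_zword mulgA.
rewrite reduced_word_length; first by rewrite size_cat size_zword leq_addr.
apply: reduced_cat; first exact: reduced_zword.
  apply: reduced_cat rw (reduced_zword _ _) _ => u' a b v' ew /zword_first ->.
  exact: wt ew.
move=> u' a b v' /zword_last ->; case: w w0 ws {wt rw} => [|c w] w0 ws /=.
  by move=> /zword_first ->; apply: w0.
by case=> <- _; rewrite eq_sym; apply: ws.
Qed.

Lemma letter_val_zpow a :
  letter_val gen a = zpow (gen a.1) (if a.2 then -1 else 1)%R.
Proof. by case: a => s []. Qed.

(** Two axes of the tree either coincide or diverge.  Strip from the reduced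
    word of [k] the letters [s] on the left and [t] on the right: either it is
    exhausted with [s = t], or nothing can cancel any more. The constant [c]
    counts the letters stripped on the left. *)
Lemma lines_apart s t k :
  (s = t /\ exists z, k = zpow (gen s) z) \/
  exists c, forall x y,
    `|x|%N <= word_length (zpow (gen s) x * k * zpow (gen t) y) + c.
Proof.
rewrite -(pres_reprK k); move: (pres_repr k) => w {k}.
elim: {w}_.+1 {-2}w (ltnSn (size w)) => // n IHn w0.
have [w rw [<- sw]] := reduced_form w0; rewrite ltnS => /(leq_trans sw) {w0 sw}.
have [ew|w0] := eqVneq w [::].
  rewrite {w rw}ew => _.
  have [->|st] := eqVneq s t; first by left; split=> //; exists 0%R.
  right; exists 0 => x y; rewrite addn0.
  by apply: lines_apart_reduced => //= u a; case: u.
have [[b [v [ew bs]]]|ws] := pselect (exists b v, w = b :: v /\ b.1 = s).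
  move: ew rw => -> /= _ /(IHn v) {w w0} IHv.
  rewrite pres_class_cons letter_val_zpow bs.
  set e : int := (if _ then _ else _).
  have e1 : `|e|%N = 1%N by rewrite /e; case: ifP.
  clearbody e; case: IHv => [[st [z ->]]|[c Hc]]; [left|right].
    by split=> //; exists (e + z)%R; rewrite zpowD.
  exists c.+1 => x y; rewrite mulgA -zpowD.
  have := Hc (x + e)%R y; move: (word_length _) => L; lia.
have [[u [a [ew at_]]]|wt] := pselect (exists u a, w = rcons u a /\ a.1 = t).
  move: ew rw => -> /= _; rewrite size_rcons => /(IHn u) {w w0 ws} IHu.
  rewrite -cats1 pres_class_cat pres_class_letter letter_val_zpow at_.
  set e := (if _ then _ else _).
  case: IHu => [[st [z ->]]|[c Hc]]; [left|right].
    by split=> //; exists (z + e)%R; rewrite -st zpowD.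
  by exists c => x y; rewrite -!mulgA -zpowD mulgA; apply: Hc.
move=> _; right; exists 0 => x y; rewrite addn0; apply: lines_apart_reduced => //.
- by move=> ew; rewrite ew in w0.
- by move=> b v ew; apply/eqP => bs; apply: ws; exists b, v.
- by move=> u a ew; apply/eqP => bs; apply: wt; exists u, a.
Qed.

Lemma bridge_length s t k x y : s != t -> k != 0%R ->
  `|x|%N <= word_length (zpow (gen s) x * zpow (gen t) k * zpow (gen s) y).
Proof.
move=> st k0; rewrite -(pres_class_zword _ t); apply: lines_apart_reduced.
- exact: reduced_zword.
- by move=> /(congr1 size); rewrite size_zword /=; lia.
- by move=> b v /zword_first ->; rewrite eq_sym.
- by move=> u a /zword_last ->; rewrite eq_sym.
Qed.

End FreeGroup.

(** * Lines of a right-angled Artin group *)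

Local Notation norel S := (fun _ _ : word S => False).

Lemma norel_respects (S : choiceType) (gT : groupType) (f : S -> gT) :
  respects (norel S) f.
Proof. by []. Qed.

Lemma pres_lift_letter (S : choiceType) (rel : word S -> word S -> Prop)
    (gT : groupType) (f : S -> gT) (hf : respects rel f) a :
  pres_lift hf (letter_val (pres_gen rel) a) = letter_val f a.
Proof. by rewrite -pres_class_letter pres_lift_class /word_val big_seq1. Qed.

Lemma commute_letter_val (S : choiceType) (gT : groupType) (f : S -> gT) x a :
  commute x (f a.1) -> commute x (letter_val f a).
Proof. by rewrite /letter_val; case: (a.2) => // /commuteV. Qed.

Section Raag.
Variable G : sgraph.
Local Notation gen := (pres_gen (@raag_rel G)).
Implicit Types (g : raag G) (u v : G).

Lemma gen_commute u v : adj u v -> commute (gen u) (gen v).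
Proof.
move=> uv; rewrite /commute -!pres_class_cat.
by apply/pres_classP/pres_rel/RaagComm.
Qed.

Definition from_free := pres_lift (norel_respects gen).

HB.instance Definition _ :=
  UMagmaMorphism.copy from_free (pres_lift (norel_respects gen)).

Lemma from_free_gen u : from_free (pres_gen (norel G) u) = gen u.
Proof. exact: pres_lift_gen. Qed.

Section Retraction.
Variable P : pred G.
Hypothesis indepP : forall u v, P u -> P v -> ~~ adj u v.

(** Vertices outside [P] are killed.  As [P] contains no edge, the image is
    free; it is placed in the free group on all the vertices to keep the types
    independent of [P]. *)
Definition retract_gen u : pres_group (norel G) :=
  if P u then pres_gen (norel G) u else 1.

Lemma retract_respects : respects (@raag_rel G) retract_gen.
Proof.
move=> _ _ [u v uv]; rewrite /word_val !big_cons !big_nil /letter_val /=.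
rewrite /retract_gen !mulg1; have := @indepP u v; rewrite uv.
by case: (P u) (P v) => [] [] H; rewrite ?mulg1 ?mul1g //; have := H isT isT.
Qed.

Definition retract := pres_lift retract_respects.

HB.instance Definition _ :=
  UMagmaMorphism.copy retract (pres_lift retract_respects).

Lemma retract_length g : word_length (retract g) <= word_length g.
Proof.
apply: word_length_lift => u; rewrite /retract_gen; case: ifP => _.
  exact: word_length_class.
by rewrite word_length1.
Qed.

Lemma retract_in u : P u -> retract (gen u) = pres_gen (norel G) u.
Proof. by rewrite /retract pres_lift_gen /retract_gen => ->. Qed.

Lemma retract_out u : ~~ P u -> retract (gen u) = 1.
Proof. by rewrite /retract pres_lift_gen /retract_gen => /negbTE->. Qed.

End Retraction.

Definition line g v (z : int) : raag G := g * zpow (gen v) z.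

Definition coarse_in (X Y : int -> raag G) :=
  exists B, forall x, exists y, word_dist (X x) (Y y) <= B.

Lemma line_dist g v x g' v' y :
  word_dist (line g v x) (line g' v' y) =
  word_length (zpow (gen v) (- x)%R * (g^-1 * g') * zpow (gen v') y).
Proof. by rewrite /word_dist /line invgM zpowN !mulgA. Qed.

(** The retraction onto the powers of [b] already sees the distance. *)
Lemma crossing_lines_diverge g a b : a != b ->
  ~ coarse_in (line g b) (line g a).
Proof.
move=> ab [B HB]; have [x Bx] : exists x : int, B < `|x|%N by exists B.+1.
have [y] := HB x.
have ind u v : pred1 b u -> pred1 b v -> ~~ adj u v.
  by move=> /eqP-> /eqP->; rewrite adj_irr.
rewrite line_dist mulVg mulg1 => le.
have := leq_trans (retract_length ind _) le.
rewrite gmulfM /= !morph_zpow /= retract_in //= retract_out //=.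
have -> : zpow (1 : pres_group (norel G)) y = 1.
  by case: (y) => n /=; rewrite ?expg1n ?invg1.
by rewrite mulg1 zpow_length abszN leqNgt Bx.
Qed.

(** In the free group on [a] and [b], the word [a^-x b^k a^y] is reduced. *)
Lemma bridged_lines_diverge g a b k : a != b -> ~~ adj a b -> k != 0%R ->
  ~ coarse_in (line g a) (line (g * zpow (gen b) k) a).
Proof.
move=> ab nab k0 [B HB].
have [x Bx] : exists x : int, B < `|x|%N by exists B.+1.
have [y] := HB x.
have ind u v : pred2 a b u -> pred2 a b v -> ~~ adj u v.
  by move=> /pred2P[]-> /pred2P[]->; rewrite ?adj_irr // adj_sym.
rewrite line_dist mulKg => le.
have := leq_trans (retract_length ind _) le.
rewrite !gmulfM /= !morph_zpow /= !retract_in /= ?eqxx ?orbT //.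
move=> le'; have := leq_trans (bridge_length _ _ ab k0) le'.
by rewrite abszN leqNgt Bx.
Qed.

End Raag.

(** * Products of free groups *)

Section Multipartite.
Variables (L : sgraph) (I : eqType) (c : L -> I).
Hypothesis cP : forall u v : L, adj u v = (c u != c v).
Local Notation gen := (pres_gen (@raag_rel L)).
Local Notation fgen := (pres_gen (norel L)).

Lemma part_indep i u v : [pred u | c u == i] u -> [pred u | c u == i] v ->
  ~~ adj u v.
Proof. by rewrite cP /= => /eqP-> /eqP->; rewrite eqxx. Qed.

Definition proj i := retract (@part_indep i).

HB.instance Definition _ i :=
  UMagmaMorphism.copy (proj i) (retract (@part_indep i)).

Lemma proj_letter i a : proj i (letter_val gen a) =
  letter_val (retract_gen [pred u | c u == i]) a.
Proof. exact: pres_lift_letter. Qed.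

Lemma proj_gen_in i s : c s = i -> proj i (gen s) = fgen s.
Proof. by move=> si; rewrite [LHS]retract_in //= si. Qed.

Lemma proj_gen_out i s : c s != i -> proj i (gen s) = 1.
Proof. by move=> si; rewrite [LHS]retract_out. Qed.

Lemma proj_length i x : word_length (proj i x) <= word_length x.
Proof. exact: retract_length. Qed.

Lemma proj_line i h s z : c s = i ->
  proj i (line h s z) = proj i h * zpow (fgen s) z.
Proof.
by move=> si; rewrite gmulfM /= morph_zpow /= proj_gen_in.
Qed.

Lemma proj_line_out i h s z : c s != i -> proj i (line h s z) = proj i h.
Proof.
move=> si; rewrite gmulfM /= morph_zpow /= proj_gen_out //.
by case: (z) => n /=; rewrite ?expg1n ?invg1 mulg1.
Qed.

Local Notation incl := (@from_free L).

Lemma factor_commute a i x : c a.1 != i ->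
  commute (letter_val gen a) (incl (proj i x)).
Proof.
move=> ai; elim/pres_ind: x => [|b x IHx].
  by rewrite !gmulf1; apply: commute1.
rewrite !gmulfM /=; apply: commuteM IHx.
rewrite proj_letter; case: b => t b.
have ct : commute (letter_val gen a) (incl (retract_gen [pred u | c u == i] t)).
  rewrite /retract_gen /=; case: eqP => [ti|_]; last first.
    by rewrite gmulf1; apply: commute1.
  rewrite from_free_gen; apply/commute_sym/commute_letter_val/gen_commute.
  by rewrite cP ti eq_sym.
by rewrite /letter_val /=; case: b; rewrite ?gmulfV //=; apply: commuteV.
Qed.

(** Letters of the factor [i] commute with the letters of the other factors, so
    that they can be gathered on the left. *)
Lemma factor_split i x : exists y,
  x = incl (proj i x) * y /\ forall s, c s = i -> commute (gen s) y.
Proof.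
elim/pres_ind: x => [|a x [y [ex cy]]].
  exists 1; split=> [|s _]; last exact: commute1.
  by rewrite !gmulf1 mulg1.
rewrite gmulfM /= proj_letter.
have [ai|ai] := eqVneq (c a.1) i.
  exists y; split=> //; rewrite gmulfM /= -mulgA -ex; congr (_ * _).
  rewrite /letter_val /retract_gen /= ai eqxx; case: (a.2).
    by rewrite gmulfV /= from_free_gen.
  by rewrite from_free_gen.
exists (letter_val gen a * y); split=> [|s si]; last first.
  apply: commuteM (cy s si); apply: commute_letter_val; apply: gen_commute.
  by rewrite cP si eq_sym.
have -> : letter_val (retract_gen [pred u | c u == i]) a = 1.
  rewrite /letter_val /retract_gen /= (negbTE ai); case: (a.2) => //.
  exact: invg1.
by rewrite mul1g {1}ex !mulgA; congr (_ * _); apply: factor_commute.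
Qed.

Lemma proj1_commute s y : proj (c s) y = 1 -> commute (gen s) y.
Proof.
move=> y1; have [y' [-> cy]] := factor_split (c s) y.
by rewrite y1 gmulf1 mul1g; apply: cy.
Qed.

(** The hypothesis expresses that [h<s>] and [h'<s>] run along the same axis in
    the factor of [s].  Then [y = s^-z h^-1 h'] has trivial component in this
    factor, so it commutes with [s], and its length is the distance between
    corresponding points all along the lines. *)
Lemma same_axis_parallel s h h' z :
  proj (c s) h' = proj (c s) h * zpow (fgen s) z ->
  exists B, forall x, word_dist (line h s x) (line h' s (x - z)) <= B.
Proof.
move=> e; set y := zpow (gen s) (- z)%R * (h^-1 * h').
have y1 : proj (c s) y = 1.
  rewrite /y !gmulfM gmulfV /= morph_zpow /= proj_gen_in // e zpowN.
  by rewrite mulKg mulVg.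
exists (word_length y) => x; rewrite line_dist.
have -> : h^-1 * h' = zpow (gen s) z * y by rewrite /y zpowN mulVKg.
rewrite mulgA -zpowD; have /commute_sym cy := proj1_commute y1.
rewrite -mulgA (commute_zpow (x - z)%R cy) mulgA -zpowD.
by rewrite addrACA addNr add0r subrr mul1g.
Qed.

(** Look at the factor of [s]: there the first line is an axis.  The second
    one cannot be a point, since the axis is unbounded, and cannot be another
    axis, since those diverge. *)
Lemma coarse_in_same_axis h s h' s' :
  coarse_in (line h s) (line h' s') ->
  s = s' /\ exists z, proj (c s) h' = proj (c s) h * zpow (fgen s) z.
Proof.
case=> B HB; set k := (proj (c s) h)^-1 * proj (c s) h'.
have pB x : exists y,
    word_length (zpow (fgen s) (- x)%R * k *
      (if c s' == c s then zpow (fgen s') y else 1)) <= B.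
  have [y le] := HB x; exists y; apply: leq_trans le.
  apply: leq_trans (proj_length (c s) _).
  rewrite gmulfM gmulfV /= proj_line //.
  case: eqP => [e|/eqP e]; [rewrite proj_line|rewrite proj_line_out] => //.
    by rewrite invgM -zpowN /k !mulgA.
  by rewrite invgM -zpowN mulg1 /k !mulgA.
case: eqP pB => [e|_] pB; last first.
  have [x Bx] : exists x : int, B + word_length k < `|x|%N.
    by exists (B + word_length k).+1.
  have [y] := pB x; rewrite mulg1 => le.
  have := word_lengthM (zpow (fgen s) (- x)%R * k) k^-1.
  by rewrite mulgK zpow_length abszN word_lengthV; lia.
have [[ss' [z ez]]|[d Hd]] := lines_apart s s' k.
  by split=> //; exists z; rewrite -ez /k mulVKg.
have [x Bx] : exists x : int, B + d < `|x|%N by exists (B + d).+1.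
have [y /= le] := pB x.
have := leq_trans (Hd (- x)%R y) (leq_add le (leqnn d)).
by rewrite abszN leqNgt Bx.
Qed.

End Multipartite.

(** * Stable embeddings in products of free groups *)

Section StableEmbedding.
Variables (G L : sgraph) (I : eqType) (c : L -> I).
Hypothesis cP : forall u v : L, adj u v = (c u != c v).
Variables (phi : raag G -> raag L) (N : nat).
Local Notation fgen := (pres_gen (norel L)).
Local Notation proj := (proj cP).

Hypothesis phi_upper : forall x y,
  word_dist (phi x) (phi y) <= N * word_dist x y + N.
Hypothesis phi_lower : forall x y,
  word_dist x y <= N * word_dist (phi x) (phi y) + N.

Definition shadows g (v : G) h (s : L) :=
  (forall x, exists y, word_dist (phi (line g v x)) (line h s y) <= N) /\
  (forall y, exists x, word_dist (phi (line g v x)) (line h s y) <= N).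

Hypothesis phi_stable : forall g v, exists h s, shadows g v h s.

(** Pass from the line [g<v>] to its shadow, along the parallel shadow, and back
    by the lower quasiisometry bound. *)
Lemma same_axis_coarse_in g v h g' v' h' s z :
  shadows g v h s -> shadows g' v' h' s ->
  proj (c s) h' = proj (c s) h * zpow (fgen s) z ->
  coarse_in (line g v) (line g' v').
Proof.
move=> [toh _] [_ fromh'] /same_axis_parallel[B HB].
exists (N * (N + (B + N)) + N) => x.
have [y le1] := toh x; have le2 := HB y; have [x' le3] := fromh' (y - z)%R.
exists x'; apply: leq_trans (phi_lower _ _) _.
rewrite leq_add2r leq_mul2l; apply/orP; right.
apply: leq_trans (word_dist_trans (line h s y) _ _) _; rewrite leq_add //.
apply: leq_trans (word_dist_trans (line h' s (y - z)) _ _) _.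
by rewrite leq_add // word_dist_sym.
Qed.

Lemma coarse_in_shadow_axis g v h s g' v' h' s' :
  shadows g v h s -> shadows g' v' h' s' ->
  coarse_in (line g v) (line g' v') ->
  s = s' /\ exists z, proj (c s) h' = proj (c s) h * zpow (fgen s) z.
Proof.
move=> [_ fromh] [toh' _] [B HB]; apply: (coarse_in_same_axis cP).
exists (N + (N * B + N + N)) => y.
have [x le1] := fromh y; have [x' le2] := HB x; have [y' le3] := toh' x'.
exists y'; apply: leq_trans (word_dist_trans (phi (line g v x)) _ _) _.
rewrite leq_add //; first by rewrite word_dist_sym.
apply: leq_trans (word_dist_trans (phi (line g' v' x')) _ _) _.
rewrite leq_add //; apply: leq_trans (phi_upper _ _) _.
by rewrite leq_add2r leq_mul2l le2 orbT.
Qed.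

Lemma proj_dist i x y :
  word_dist (proj i x) (proj i y) <= word_dist x y.
Proof. by rewrite /word_dist -gmulfV -gmulfM; apply: proj_length. Qed.

(** All the lines through [g b^n] in the direction [a] are parallel, hence share
    the axis of [g<a>].  In a common factor the axis of [g<b>] would stay close
    to it, so would be equal to it. *)
Lemma adjacent_shadows g (a b : G) h s h' t : adj a b ->
  shadows g a h s -> shadows g b h' t -> c s != c t.
Proof.
move=> ab sha shb; apply/eqP => st.
(* The image of [g<b>] stays close to the axis of [g<a>]: at the point [g b^x]
   it meets the image of a parallel of [g<a>]. *)
have near_axis x : exists y, word_dist (proj (c s) (phi (line g b x)))
    (proj (c s) h * zpow (fgen s) y) <= N.
  have [h1 [s1 sh1]] := phi_stable (line g b x) a.
  have [|ss1 [z ez]] := coarse_in_shadow_axis sha sh1.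
    exists `|x|%N => y; exists y; rewrite line_dist mulKg.
    have cab := commute_zpow x (gen_commute ab).
    have /commute_sym cab' := commute_zpow (- y)%R (commute_sym cab).
    rewrite cab' -mulgA -zpowD addNr mulg1 -pres_class_zword.
    by rewrite (leq_trans (word_length_class _ _)) // size_zword.
  subst s1; have [y le] := sh1.1 0%R; exists (z + y)%R.
  rewrite zpowD mulgA -ez -(proj_line cP) //.
  apply: leq_trans (proj_dist _ _ _) _; move: le.
  by rewrite /line mulg1.
(* The axis of [g<b>] lies in the [2N]-neighbourhood of that of [g<a>]. *)
have near y : exists y', word_length (zpow (fgen t) (- y)%R *
    ((proj (c s) h')^-1 * proj (c s) h) * zpow (fgen s) y') <= N + N.
  have [x le1] := shb.2 y; have [y' le2] := near_axis x; exists y'.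
  have -> : zpow (fgen t) (- y)%R * ((proj (c s) h')^-1 * proj (c s) h) *
      zpow (fgen s) y' =
      (proj (c s) (line h' t y))^-1 * (proj (c s) h * zpow (fgen s) y').
    by rewrite proj_line // zpowN invgM !mulgA.
  apply: leq_trans (word_dist_trans (proj (c s) (phi (line g b x))) _ _) _.
  rewrite leq_add // word_dist_sym; apply: leq_trans le1; exact: proj_dist.
have [[ts [z ez]]|[d Hd]] :=
    lines_apart t s ((proj (c s) h')^-1 * proj (c s) h).
  subst t; have e : proj (c s) h = proj (c s) h' * zpow (fgen s) z.
    by rewrite -ez mulVKg.
  have := same_axis_coarse_in shb sha e; apply: crossing_lines_diverge.
  by apply: contraTneq ab => ->; rewrite adj_irr.
have [x Bx] : exists x : int, N + N + d < `|x|%N by exists (N + N + d).+1.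
have [y le] := near x.
have := leq_trans (Hd (- x)%R y) (leq_add le (leqnn d)).
by rewrite abszN leqNgt Bx.
Qed.

(** The line at [d^n] whose factor is not that of [<d>] is described by
    finite data: which of [a], [b] directs it, the direction of its shadow, and
    a short word leading from the almost constant position of [<d>] in that
    factor to a point of the axis. *)
Lemma far_shadow (a b d : G) h s n : adj a b -> shadows 1 d h s ->
  exists p : bool * L * (N + N).-bseq (letter L), exists h' y,
    [/\ shadows (zpow (pres_gen _ d) n) (if p.1.1 then a else b) h' p.1.2,
        c p.1.2 != c s &
        proj (c p.1.2) h' * zpow (fgen p.1.2) y =
        proj (c p.1.2) h * pres_class (norel L) p.2].
Proof.
move=> ab shd; set g := zpow _ n.
have [e [h' [t [sht ts]]]] : exists e : bool, exists h' t,
    shadows g (if e then a else b) h' t /\ c t != c s.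
  have [h1 [s1 sh1]] := phi_stable g a; have [h2 [s2 sh2]] := phi_stable g b.
  have [e1|ne1] := eqVneq (c s1) (c s); last by exists true, h1, s1.
  exists false, h2, s2; split=> //.
  by rewrite -e1 eq_sym (adjacent_shadows ab sh1 sh2).
have [y le] := sht.1 0%R; have [y' le'] := shd.1 n.
set k := (proj (c t) h)^-1 * (proj (c t) h' * zpow (fgen t) y).
(* Both [h] and the point [y] of the axis project close to the image of
   [d^n]; the former because [<d>] lives in another factor. *)
have [w ew sw] := word_lengthP k.
have szw : size w <= N + N.
  rewrite sw /k -(proj_line_out cP h y' _ (i := c t) (s := s)) 1?eq_sym //.
  rewrite -(proj_line cP) //.
  apply: leq_trans (word_dist_trans (proj (c t) (phi g)) _ _) _.
  apply: leq_add; apply: leq_trans (proj_dist _ _ _) _.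
    by rewrite word_dist_sym; move: le'; rewrite /line mul1g.
  by move: le; rewrite /line mulg1.
exists (e, t, Bseq szw), h', y; split=> //=.
by rewrite ew /k mulVKg.
Qed.

(** The data of [far_shadow] take finitely many values, so two points of [<d>]
    share them: there two lines in the same direction [a] or [b] have the same
    axis, hence are close, although the bridge between them is a nontrivial
    power of [d], which commutes with neither. *)
Lemma nonadjacent_trans (a b d : G) : adj a b -> adj d a || adj d b.
Proof.
move=> ab; apply: contraT; rewrite negb_or => /andP[nda ndb]; exfalso.
have [h [s shd]] := phi_stable 1 d.
pose T := (bool * L * (N + N).-bseq (letter L))%type.
have [f Hf] := choice (fun n : nat => far_shadow n%:Z%R ab shd).
have /injectivePn[n [m nm fnm]] :
    ~~ injectiveb (fun n : 'I_#|{: T}|.+1 => f n : T).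
  by apply/injectiveP => /leq_card; rewrite card_ord ltnn.
have [h1 [y1 [sh1 cs1 e1]]] := Hf n; have [h2 [y2 [sh2 _ e2]]] := Hf m.
rewrite -fnm in sh2 e2; set t := (f n).1.2 in sh1 sh2 e1 e2 cs1.
set v := (if _ then _ else _) in sh1 sh2.
have e : proj (c t) h2 = proj (c t) h1 * zpow (fgen t) (y1 - y2)%R.
  by rewrite zpowD zpowN mulgA e1 -e2 mulgK.
have := same_axis_coarse_in sh1 sh2 e.
have -> : zpow (pres_gen (@raag_rel G) d) m =
   zpow (pres_gen _ d) n * zpow (pres_gen _ d) (m%:Z - n%:Z)%R.
  by rewrite -zpowD addrC subrK.
have dv : ~~ adj v d by rewrite adj_sym /v; case: ifP.
apply: bridged_lines_diverge dv _; last first.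
  by rewrite subr_eq0; apply: contra nm => /eqP[] /val_inj->.
rewrite /v; case: ifP => _.
  by apply: contra ndb => /eqP<-.
by apply: contra nda => /eqP<-; rewrite adj_sym.
Qed.

End StableEmbedding.

(** * Complete multipartite graphs give products of free groups *)

Lemma prodgM_commute_neq (gT : groupType) (I : eqType) (r : seq I)
    (F H : I -> gT) :
  uniq r -> (forall i j, i != j -> commute (F i) (H j)) ->
  \prod_(i <- r) (F i * H i) = \prod_(i <- r) F i * \prod_(i <- r) H i.
Proof.
move=> + FH; elim: r => [|i r IHr] /=; first by rewrite !big_nil mulg1.
move=> /andP[ir /IHr e]; rewrite !big_cons e !mulgA; congr (_ * _).
rewrite -!mulgA; congr (_ * _); rewrite big_seq.
apply: commute_prod => j jr; apply/commute_sym/FH.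
by apply: contraNneq ir => <-.
Qed.

Section Classification.
Variables (G : sgraph) (m : nat) (c : G -> 'I_m).
Hypothesis cP : forall u v : G, adj u v = (c u != c v).
Local Notation gen := (pres_gen (@raag_rel G)).

Definition part_rank (i : 'I_m) : nat := #|[pred u | c u == i]|.
Local Notation factor i := (free_group (part_rank i)).

(** The option returned by [pick] avoids a cast between the dependent types of
    the factors: it is [None] exactly when [u] is not in the part [i]. *)
Definition factor_gen i u : factor i :=
  if [pick k : 'I_(part_rank i) | enum_val k == u] is Some k
  then pres_gen (norel 'I_(part_rank i)) k else 1.

Lemma factor_gen_in i (k : 'I_(part_rank i)) :
  factor_gen i (enum_val k) = pres_gen (norel 'I_(part_rank i)) k.
Proof.
rewrite /factor_gen; case: pickP => [k' /eqP/enum_val_inj-> //|/(_ k)].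
by rewrite eqxx.
Qed.

Lemma part_enum_val i (k : 'I_(part_rank i)) : c (enum_val k) = i.
Proof. by have /eqP := enum_valP k. Qed.

Lemma factor_gen_out i u : c u != i -> factor_gen i u = 1.
Proof.
rewrite /factor_gen; case: pickP => // k /eqP <-.
by rewrite part_enum_val eqxx.
Qed.

Lemma factor_respects i : respects (@raag_rel G) (factor_gen i).
Proof.
move=> _ _ [u v]; rewrite cP => uv.
rewrite /word_val !big_cons !big_nil /letter_val /= !mulg1.
have [ui|ui] := eqVneq (c u) i; last by rewrite (factor_gen_out ui) mulg1 mul1g.
have vi : c v != i by rewrite -ui eq_sym.
by rewrite (factor_gen_out vi) mulg1 mul1g.
Qed.

Definition to_factor i : raag G -> factor i := pres_lift (@factor_respects i).
Definition from_factor i : factor i -> raag G :=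
  pres_lift (norel_respects (fun k : 'I_(part_rank i) => gen (enum_val k))).

HB.instance Definition _ i :=
  UMagmaMorphism.copy (@to_factor i) (pres_lift (@factor_respects i)).
HB.instance Definition _ i := UMagmaMorphism.copy (@from_factor i)
  (pres_lift (norel_respects (fun k : 'I_(part_rank i) => gen (enum_val k)))).

Lemma to_factor_letter i a :
  to_factor i (letter_val gen a) = letter_val (factor_gen i) a.
Proof. exact: pres_lift_letter. Qed.

Lemma from_factor_letter i a :
  from_factor (letter_val (pres_gen (norel 'I_(part_rank i))) a) =
  letter_val (fun k : 'I_(part_rank i) => gen (enum_val k)) a.
Proof. exact: pres_lift_letter. Qed.

Lemma to_factorK i : cancel (@from_factor i) (@to_factor i).
Proof.
elim/pres_ind=> [|a x IHx]; first by rewrite !gmulf1.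
rewrite !gmulfM /= IHx from_factor_letter; congr (_ * _).
rewrite -[letter_val _ a]/(letter_val gen (enum_val a.1, a.2)) to_factor_letter.
by rewrite /letter_val /= factor_gen_in.
Qed.

Lemma from_factor_commute i a x : c a.1 != i ->
  commute (letter_val gen a) (@from_factor i x).
Proof.
move=> ai; elim/pres_ind: x => [|b x IHx].
  by rewrite gmulf1; apply: commute1.
rewrite gmulfM /= from_factor_letter; apply: commuteM IHx.
apply: commute_letter_val; apply/commute_sym/commute_letter_val/gen_commute.
by rewrite cP part_enum_val eq_sym.
Qed.

Lemma to_factor_out i j x : i != j -> to_factor j (@from_factor i x) = 1.
Proof.
move=> ij; elim/pres_ind: x => [|a x IHx]; first by rewrite !gmulf1.
rewrite !gmulfM /= IHx mulg1 from_factor_letter.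
rewrite -[letter_val _ a]/(letter_val gen (enum_val a.1, a.2)) to_factor_letter.
by rewrite /letter_val /= factor_gen_out ?part_enum_val // invg1 if_same.
Qed.

Lemma from_to_letter a :
  from_factor (to_factor (c a.1) (letter_val gen a)) = letter_val gen a.
Proof.
have a1 : a.1 \in [pred u | c u == c a.1] by rewrite inE.
case: a a1 => u b /= a1.
have from_gen : from_factor (factor_gen (c u) u) = gen u.
  rewrite -[u in factor_gen _ u](enum_rankK_in a1 a1) factor_gen_in.
  by rewrite [LHS]pres_lift_gen enum_rankK_in.
rewrite to_factor_letter /letter_val /=; case: b => //.
by rewrite gmulfV /= from_gen.
Qed.

Definition to_prod (x : raag G) : direct_prod (fun i : 'I_m => factor i) :=
  [ffun i : 'I_m => (to_factor i x : factor i)].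
Definition from_prod (y : direct_prod (fun i : 'I_m => factor i)) : raag G :=
  \prod_(i < m) from_factor (y i).

Lemma to_prodM : {morph to_prod : x y / x * y}.
Proof. by move=> x y; apply/ffunP => i; rewrite !ffunE gmulfM. Qed.

HB.instance Definition _ := isMultiplicative.Build _ _ to_prod to_prodM.

Lemma from_prodK : cancel from_prod to_prod.
Proof.
move=> y; apply/ffunP => i; rewrite ffunE gmulf_prod /=.
rewrite (@big_only1 _ _ _ _ i) ?to_factorK // => j ji _.
exact: to_factor_out.
Qed.

Lemma to_prodK : cancel to_prod from_prod.
Proof.
elim/pres_ind=> [|a x IHx].
  by rewrite /from_prod big1 // => i _; rewrite ffunE !gmulf1.
rewrite -{2}IHx /from_prod.
under eq_bigr => i _ do rewrite ffunE !gmulfM /=.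
rewrite prodgM_commute_neq ?index_enum_uniq //; last first.
  move=> i j ij; have [ai|ai] := eqVneq (c a.1) i; last first.
    rewrite to_factor_letter /letter_val factor_gen_out // invg1 if_same gmulf1.
    exact/commute_sym/commute1.
  by rewrite -ai in ij *; rewrite from_to_letter; apply: from_factor_commute.
congr (_ * _); last by apply: eq_bigr => i _; rewrite ffunE.
rewrite (@big_only1 _ _ _ _ (c a.1)) ?from_to_letter // => i ia _.
rewrite to_factor_letter /letter_val factor_gen_out 1?eq_sym // invg1 if_same.
exact: gmulf1.
Qed.

End Classification.

(** Non-adjacency is an equivalence relation, and its classes, indexed by
    canonical representatives, are the parts; an index that represents no class
    contributes a trivial factor. *)
Theorem multipartite_raag (G : sgraph) :
  (forall u v w : G, adj u v -> adj w u || adj w v) ->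
  exists (m : nat) (q : 'I_m -> nat),
    isomorphic_groups (raag G) (direct_prod (fun i : 'I_m => free_group (q i))).
Proof.
move=> adjT; pose rep (u : G) := odflt u [pick w | ~~ adj u w].
pose c u := enum_rank (rep u).
have repP u : ~~ adj u (rep u).
  rewrite /rep; case: pickP => [w //|/(_ u)].
  by rewrite adj_irr.
have cP u v : adj u v = (c u != c v).
  rewrite (inj_eq enum_rank_inj); apply/idP/idP => [/adjT uv|].
    apply: contraTneq (uv (rep u)) => e.
    by rewrite negb_or ![adj (rep u) _]adj_sym {2}e !repP.
  apply: contraR => nuv; apply/eqP; rewrite /rep.
  have -> : [pick w | ~~ adj u w] = [pick w | ~~ adj v w].
    apply: eq_pick => w; congr (~~ _); apply/idP/idP => [/adjT|/adjT].
      by move=> /(_ v); rewrite adj_sym (negbTE nuv).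
    by move=> /(_ u); rewrite (negbTE nuv).
  by case: pickP => // /(_ v); rewrite adj_irr.
exists #|G|, (part_rank c), (to_prod cP).
by exists (@from_prod _ _ c); [apply: to_prodK|apply: from_prodK].
Qed.

(** * The theorem *)

Lemma standard_geodesicP (G : sgraph) (X : set (raag G)) :
  standard_geodesic X <-> exists g v, X = range (line g v).
Proof.
have lineP g v : [set x | exists n : nat,
      x = g * pres_gen (@raag_rel G) v ^+ n \/
      x = g * pres_gen (@raag_rel G) v ^- n]%classic = range (line g v).
  apply/seteqP; split=> [x [n [->|->]]|_ [z _ <-]] /=.
  - by exists n.
  - by exists (- n%:Z)%R; rewrite // /line zpowN.
  - by case: z => n; [exists n; left|exists n.+1; right].
by split=> -[g [v ->]]; exists g, v.
Qed.

(** Word distances are integers, so a single integer above [K], [C], [K * C]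
    and [D] serves for all the estimates; the product [K * C] arises when the
    lower bound is solved for the distance in the source. *)
Lemma quasiisometric_embedding_nat (R : realType) (G L : sgraph)
    (phi : raag G -> raag L) :
  quasiisometric_embedding R phi -> stable R phi ->
  exists N, [/\
    forall x y, word_dist (phi x) (phi y) <= N * word_dist x y + N,
    forall x y, word_dist x y <= N * word_dist (phi x) (phi y) + N &
    forall g v, exists h s, shadows phi N g v h s].
Proof.
case=> K [C [K1 C0 phiKC]] [D phiD].
pose N := Num.bound K + Num.bound C + Num.bound (K * C)%R + Num.bound `|D|%R.
have K0 : (0 < K)%R by apply: lt_le_trans K1.
have le_bound (x : R) n : (0 <= x)%R -> Num.bound x <= n -> (x <= n%:R)%R.
  move=> x0 xn; apply: le_trans (ltW (archi_boundP x0)) _.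
  by rewrite ler_nat.
have KN : (K <= N%:R)%R by apply: le_bound (ltW K0) _; rewrite /N; lia.
have CN : (C <= N%:R)%R by apply: le_bound C0 _; rewrite /N; lia.
have KCN : (K * C <= N%:R)%R.
  apply: le_bound; first exact: mulr_ge0 (ltW K0) C0.
  by rewrite /N -addnA addnCA leq_addr.
have DN : (D <= N%:R)%R.
  by apply: le_trans (ler_norm _) _; apply: le_bound => //; rewrite /N leq_addl.
exists N; split=> [x y|x y|g v].
- rewrite -(ler_nat R) natrD natrM; have /andP[_ le] := phiKC x y.
  apply: le_trans le _; apply: lerD CN; exact: ler_wpM2r.
- rewrite -(ler_nat R) natrD natrM; have /andP[le _] := phiKC x y.
  have {}le : ((word_dist x y)%:R <= K * (word_dist (phi x) (phi y))%:R + K * C)%R.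
    rewrite -mulrDr mulrC -ler_pdivrMr // mulrC; move: le.
    by rewrite lerBlDr.
  apply: le_trans le _; apply: lerD KCN; exact: ler_wpM2r.
have [|Y] := phiD (range (line g v)).
  by apply/standard_geodesicP; exists g, v.
move=> /standard_geodesicP[h [s ->]] [toY fromY]; exists h, s; split=> [x|y].
  have [|_ [y _ <-] le] := toY (phi (line g v x)).
    by exists (line g v x) => //; exists x.
  by exists y; rewrite -(ler_nat R) (le_trans le).
have [|_ [_ [x _ <-] <-] le] := fromY (line h s y); first by exists y.
by exists x; rewrite -(ler_nat R) (le_trans le).
Qed.

Theorem theorem8 (R : realType) (G : sgraph) :
  (exists (k : nat) (r : 'I_k -> nat) (phi : raag G -> raag (join_edgeless r)),
      quasiisometric_embedding R phi /\ stable R phi) ->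
  exists (m : nat) (q : 'I_m -> nat),
    isomorphic_groups (raag G) (direct_prod (fun i : 'I_m => free_group (q i))).
Proof.
case=> k [r [phi [qi st]]].
have [N [upper lower shadow]] := quasiisometric_embedding_nat qi st.
have tagP (u v : join_edgeless r) : adj u v = (tag u != tag v) by exact: orbF.
apply: multipartite_raag => u v w.
exact: (nonadjacent_trans tagP upper lower shadow).
Qed.
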